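(* Suppose that $\mathrm{supp}\, f$ is compact (and that the components of $T$ are bounded on $\mathrm{supp}\, f$). Suppose that the components of $T$ are affine independent on $\mathrm{supp}\, f$, i.e. for every $(0,0)\neq(\lambda,\mu)\in\mathbb{R}^L\times\mathbb{R}$ there exists $x\in\mathrm{supp}\, f$ with $\langle\lambda,T(x)\rangle+\mu\neq 0$, and that $\bar T\in\mathrm{int}(\mathrm{co}\,T(D_M))$ for every $M$. Suppose also that $\lim_{M\to\infty}\sum_{i=1}^{I_M}q_{i,M}h(x_{i,M})=\int_{\mathbb{R}^K}f(x)h(x)\,dx$ for every bounded continuous $h:\mathbb{R}^K\to\mathbb{R}$, and that $\lim_{M\to\infty}\sum_{i=1}^{I_M}q_{i,M}T(x_{i,M})=\int_{\mathbb{R}^K}f(x)T(x)\,dx$. Let $g:\mathbb{R}^K\to\mathbb{R}$ be a bounded continuous function, let $b_{g,T}(x)=\sum_{l=1}^L\beta_lT_l(x)$ with coefficients $\beta_1,\dots,\beta_L\in\mathbb{R}$ be an approximation of $g$ by the components of $T$, and let $$r_{g,T}(x)=\frac{g(x)-b_{g,T}(x)}{\|g-b_{g,T}\|_\infty}$$ be the normalized residual of this approximation. Then for any $C$ with $0<C<C_\infty$ there exists a positive integer $M_C$ such that for all $M\ge M_C$, $$E^{(P)}_{g,M}\le\|g-b_{g,T}\|_\infty\left(E^{(Q)}_{r_{g,T},M}+\frac{2}{\sqrt{C}}E^{(Q)}_{T,M}\right).$$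
   Context: $f$ is a probability density function on $\mathbb{R}^K$ and $\mathrm{supp}\, f$ is its support. $T=(T_1,\dots,T_L):\mathbb{R}^K\to\mathbb{R}^L$ is a continuous function (the moment defining function), with moment $\bar T=\int_{\mathbb{R}^K}f(x)T(x)\,dx$. For each positive integer $M$, $D_M=\{x_{i,M}\mid i=1,\dots,I_M\}\subset\mathbb{R}^K$ is a given finite set of $I_M$ points, and $Q_M=\{q_{i,M}\}_{i=1}^{I_M}$ is a given discrete probability distribution on $D_M$ (an initial discretization of $f$, whose moments need not be exact), so $q_{i,M}\ge 0$ and $\sum_{i=1}^{I_M}q_{i,M}=1$. $\mathrm{co}\,T(D_M)$ is the convex hull of $\{T(x_{i,M})\}_{i=1}^{I_M}$ and $\mathrm{int}$ denotes the interior in $\mathbb{R}^L$. $\langle\cdot,\cdot\rangle$ and $\|\cdot\|$ are the usual inner product and norm on $\mathbb{R}^L$; $\|h\|_\infty=\sup_{x\in\mathbb{R}^K}|h(x)|$ for real-valued $h$. Let $\lambda_M\in\mathbb{R}^L$ be the unique maximizer over $\lambda\in\mathbb{R}^L$ of $\langle\lambda,\bar T\rangle-\log\left(\sum_{i=1}^{I_M}q_{i,M}e^{\langle\lambda,T(x_{i,M})\rangle}\right)$, and define the probability distribution $P_M=\{p_{i,M}\}$ on $D_M$ by $$p_{i,M}=\frac{q_{i,M}e^{\langle\lambda_M,T(x_{i,M})\rangle}}{\sum_{j=1}^{I_M}q_{j,M}e^{\langle\lambda_M,T(x_{j,M})\rangle}}.$$ ($P_M$ is the unique minimizer of the Kullback-Leibler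 information $\sum_i p_i\log(p_i/q_{i,M})$ subject to $\sum_i p_iT(x_{i,M})=\bar T$, $\sum_i p_i=1$, $p_i\ge0$, with the convention $0\log 0=0$.) Errors: for a real-valued function $h$, $E^{(Q)}_{h,M}=\left|\int_{\mathbb{R}^K}f(x)h(x)\,dx-\sum_{i=1}^{I_M}q_{i,M}h(x_{i,M})\right|$ and $E^{(P)}_{h,M}=\left|\int_{\mathbb{R}^K}f(x)h(x)\,dx-\sum_{i=1}^{I_M}p_{i,M}h(x_{i,M})\right|$; and $E^{(Q)}_{T,M}=\left\|\int_{\mathbb{R}^K}f(x)T(x)\,dx-\sum_{i=1}^{I_M}q_{i,M}T(x_{i,M})\right\|$. For $\alpha>0$, $C_\alpha=\inf_{\lambda\in\mathbb{R}^L,\|\lambda\|=1}\int_{\mathbb{R}^K}f(x)\left(\max\{0,\min\{\langle\lambda,T(x)-\bar T\rangle,\alpha\}\}\right)^2dx$, and $C_\infty=\lim_{\alpha\to\infty}C_\alpha$ (possibly $\infty$). *)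

(* Defs.v *)
From HB Require Import structures.
From mathcomp Require Import all_boot all_order all_algebra.
From mathcomp Require Import all_classical all_reals all_analysis.
From mathcomp Require Import measurable_realfun.

Set Implicit Arguments.
Unset Strict Implicit.
Unset Printing Implicit Defensive.

Import Order.TTheory GRing.Theory Num.Theory.
Import numFieldNormedType.Exports.

Local Open Scope classical_set_scope.
Local Open Scope ring_scope.

Section borel_rV.
Context {R : realType} {n : nat}.

Let borel : set (set 'rV[R]_n) := <<s [set U : set 'rV[R]_n | open U] >>.

Let borel0 : borel set0.
Proof. exact: sigma_algebra0. Qed.

Let borelC A : borel A -> borel (~` A).
Proof. exact: sigma_algebraC. Qed.

Let borel_bigcup (F : (set 'rV[R]_n)^nat) :
  (forall i, borel (F i)) -> borel (\bigcup_i F i).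
Proof. exact: sigma_algebra_bigcup. Qed.

(* 'rV[R]_n carries its Borel sigma-algebra, generated by the open sets. *)
HB.instance Definition _ := @isMeasurable.Build default_measure_display
  'rV[R]_n borel borel0 borelC borel_bigcup.

Lemma open_measurable_rV (U : set 'rV[R]_n) : open U -> measurable U.
Proof. by move=> oU; exact: sub_sigma_algebra. Qed.

Let rat_box (q : {ffun 'I_n -> rat * rat}) : set 'rV[R]_n :=
  [set v | forall i, ratr (q i).1 < v 0 i < ratr (q i).2].

Let open_rat_box (U : set 'rV[R]_n) : open U ->
  U = \bigcup_q (if `[< rat_box q `<=` U >] then rat_box q else set0).
Proof.
move=> oU; apply/seteqP; split => [v Uv|v [q _]]; last first.
  by case: ifPn => // /asboolP + ?; exact.
have /nbhs_ballP[e /= e0 eU] : nbhs v U by exact: open_nbhs_nbhs.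
have H i : exists p : rat * rat,
    (v 0 i - e < ratr p.1 < v 0 i) /\ (v 0 i < ratr p.2 < v 0 i + e).
  have [a] := @rat_in_itvoo R (v 0 i - e) (v 0 i) ltac:(by rewrite ltrBlDr ltrDl).
  have [b] := @rat_in_itvoo R (v 0 i) (v 0 i + e) ltac:(by rewrite ltrDl).
  by rewrite !in_itv/= => hb ha; exists (a, b).
pose q : {ffun 'I_n -> rat * rat} := [ffun i => projT1 (cid (H i))].
have qP i : (v 0 i - e < ratr (q i).1 < v 0 i) /\
    (v 0 i < ratr (q i).2 < v 0 i + e).
  by rewrite ffunE; case: cid.
exists q => //; rewrite ifT.
  by move=> i; have [/andP[_ ->] /andP[-> _]] := qP i.
apply/asboolP => w qw; apply: eU; split=> // i j; rewrite ord1.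
have /andP[q1 q2] := qw j; have [/andP[q3 _] /andP[_ q4]] := qP j.
rewrite /ball/= ltr_distlC; apply/andP; split.
  exact: lt_trans q3 q1.
exact: lt_trans q2 q4.
Qed.

Lemma measurable_fun_rV d (T : measurableType d) (f : T -> 'rV[R]_n) :
  (forall i, measurable_fun setT (fun x => f x 0 i)) -> measurable_fun setT f.
Proof.
move=> mf; apply: (@measurability _ _ _ _ _ _ [set U : set 'rV[R]_n | open U]) => //.
move=> _ [U /= oU <-]; rewrite setTI (open_rat_box oU) preimage_bigcup.
apply: countable_bigcupT_measurable; first exact: countableP.
move=> q; case: ifPn => _; last by rewrite preimage_set0.
rewrite (_ : _ @^-1` _ = \bigcap_(i in [set: 'I_n])
    ((fun x => f x 0 i) @^-1` `]ratr (q i).1, ratr (q i).2[)); last first.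
  apply/seteqP; split=> x /= h i; first by move=> _; rewrite /= in_itv/=.
  by have := h i I; rewrite /= in_itv.
apply: fin_bigcap_measurable; first exact: finite_finset.
by move=> i _; rewrite -[X in measurable X]setTI; apply: mf.
Qed.

End borel_rV.

Lemma continuous_measurable_rV (R : realType) n (h : 'rV[R]_n -> R) :
  continuous h -> measurable_fun setT h.
Proof.
move=> /continuousP ch; apply: (measurability _ (RGenOpens.measurableE R)).
move=> _ [_ [a [b ->] <-]]; rewrite setTI; apply: open_measurable_rV.
exact/ch/interval_open.
Qed.

Definition rV_cons (R : realType) n (p : 'rV[R]_n * measurableTypeR R) :
    'rV[R]_n.+1 :=
  row_mx (p.2)%:M p.1 : 'rV_(1 + n).

Lemma measurable_rV_coord (R : realType) n (i : 'I_n) :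
  measurable_fun setT (fun v : 'rV[R]_n => v 0 i).
Proof.
by apply: continuous_measurable_rV; exact: coord_continuous.
Qed.

Lemma measurable_rV_cons (R : realType) n :
  measurable_fun setT (@rV_cons R n).
Proof.
apply: measurable_fun_rV => i.
case: (@splitP 1 n i) => j ij.
  rewrite (_ : (fun x => _) = snd)//; apply/funext => -[v x] /=.
  have -> : i = @lshift 1 n j by exact: val_inj.
  by apply: etrans (row_mxEl _ _ _ _) _; rewrite mxE !ord1 eqxx.
rewrite (_ : (fun x => _) = (fun v : 'rV[R]_n => v 0 j) \o fst).
  by apply: measurableT_comp => //; exact: measurable_rV_coord.
apply/funext => -[v x] /=.
have -> : i = @rshift 1 n j by exact: val_inj.
exact: row_mxEr.
Qed.

Section lebesgue_rV_step.
Local Open Scope ereal_scope.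
Context {R : realType} {n : nat}.
Variable mu : {measure set 'rV[R]_n -> \bar R}.

Let leb_step : set 'rV[R]_n.+1 -> \bar R :=
  pushforward (mu \x (@lebesgue_measure R)) (@rV_cons R n).

Let mcons := @measurable_rV_cons R n.

Let step0 : leb_step set0 = 0.
Proof. exact: measure0. Qed.

Let step_ge0 A : 0 <= leb_step A.
Proof. exact: measure_ge0. Qed.

Let step_sigma_additive : semi_sigma_additive leb_step.
Proof. exact: measure_semi_sigma_additive. Qed.

HB.instance Definition _ := isMeasure.Build _ _ _ leb_step
  step0 step_ge0 step_sigma_additive.

Definition lebesgue_rV_step : {measure set 'rV[R]_n.+1 -> \bar R} := leb_step.

End lebesgue_rV_step.

Fixpoint lebesgue_rV {R : realType} n : {measure set 'rV[R]_n -> \bar R} :=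
  if n is m.+1 then lebesgue_rV_step (lebesgue_rV m) else dirac (0 : 'rV[R]_0).

(* The volume formula below characterizes the Borel-Lebesgue measure on R^n. *)
Lemma lebesgue_rV_box (R : realType) n (a b : 'rV[R]_n) :
  (forall i, a 0 i <= b 0 i) ->
  lebesgue_rV n [set v | forall i, a 0 i <= v 0 i <= b 0 i] =
  (\prod_(i < n) (b 0 i - a 0 i))%:E.
Proof.
elim: n a b => [|n ih] a b ab.
  rewrite big_ord0 /= diracE mem_set//; by case.
pose tl (v : 'rV[R]_n.+1) : 'rV[R]_n := \row_i v 0 (lift ord0 i).
have mbox : measurable [set v : 'rV[R]_n | forall i, tl a 0 i <= v 0 i <= tl b 0 i].
  rewrite (_ : [set v : 'rV[R]_n | _] = \bigcap_(i in [set: 'I_n])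
      ((fun v : 'rV[R]_n => v 0 i) @^-1` `[tl a 0 i, tl b 0 i])); last first.
    apply/seteqP; split=> v /= h i; first by move=> _; rewrite /= in_itv/=.
    by have := h i I; rewrite /= in_itv.
  apply: fin_bigcap_measurable; first exact: finite_finset.
  move=> i _; rewrite -[X in measurable X]setTI.
  exact: measurable_rV_coord.
have cons0 (v : 'rV[R]_n) x : rV_cons (v, x) 0 ord0 = x.
  have -> : ord0 = @lshift 1 n ord0 by exact: val_inj.
  by apply: etrans (row_mxEl _ _ _ _) _; rewrite mxE eqxx.
have consS (v : 'rV[R]_n) x i : rV_cons (v, x) 0 (lift ord0 i) = v 0 i.
  have -> : lift ord0 i = @rshift 1 n i by exact: val_inj.
  exact: row_mxEr.
rewrite /= /pushforward.
rewrite (_ : _ @^-1` _ = [set v : 'rV[R]_n | forall i, tl a 0 i <= v 0 i <= tl b 0 i] `*`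
    `[a 0 ord0, b 0 ord0]); last first.
  apply/seteqP; split=> -[v x] /=.
    move=> h; split; last by have := h ord0; rewrite cons0 in_itv.
    by move=> i; have := h (lift ord0 i); rewrite consS !mxE.
  rewrite in_itv/= => -[h1 h2] i.
  have [j ->|->] := unliftP ord0 i; last by rewrite cons0.
  by have := h1 j; rewrite consS !mxE.
rewrite product_measure1E// ih; last by move=> i; rewrite !mxE.
rewrite big_ord_recl mulrC EFinM; congr (_ * _)%E.
  by congr EFin; apply: eq_bigr => i _; rewrite !mxE.
apply: etrans (lebesgue_measure_itv _) _; rewrite /= lte_fin.
case: ifPn => //; rewrite -leNgt => h.
by rewrite (_ : b 0 ord0 = a 0 ord0) ?subrr//; apply/le_anti; rewrite h ab.
Qed.

Section discretization.
Context {R : realType} {K L : nat}.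
Implicit Types (f h : 'rV[R]_K -> R) (T : 'rV[R]_K -> 'rV[R]_L).

(* The library norm on 'rV[R]_n is the maximum norm; [enorm] is Euclidean. *)
Definition inner n (u v : 'rV[R]_n) : R := \sum_(i < n) u 0 i * v 0 i.

Definition enorm n (u : 'rV[R]_n) : R := Num.sqrt (inner u u).

Definition sup_norm h : R := sup (range (fun y => `|h y|)).

Definition convex_hull n (A : set 'rV[R]_n) : set 'rV[R]_n :=
  smallest (@convex_set R 'rV[R]_n) A.

Definition is_density f : Prop :=
  [/\ measurable_fun setT f, (forall y, 0 <= f y) &
      (\int[lebesgue_rV K]_y (f y)%:E = 1)%E].

(* Support of the function f (the given pointwise representative of the density). *)
Definition supp f : set 'rV[R]_K := closure [set y | f y != 0].

Definition expect f h : R := (\int[lebesgue_rV K]_y (f y * h y))%R.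

Definition vexpect f T : 'rV[R]_L := \row_l expect f (fun y => T y 0 l).

Definition affine_independent_on (A : set 'rV[R]_K) T : Prop :=
  forall (lam : 'rV[R]_L) (mu : R), (lam, mu) <> (0, 0) ->
    exists2 y, A y & inner lam (T y) + mu <> 0.

Definition is_distribution n (w : 'I_n -> R) : Prop :=
  (forall i, 0 <= w i) /\ \sum_(i < n) w i = 1.

Definition dexpect n (x : 'I_n -> 'rV[R]_K) (w : 'I_n -> R) h : R :=
  \sum_(i < n) w i * h (x i).

Definition dvexpect n (x : 'I_n -> 'rV[R]_K) (w : 'I_n -> R) T : 'rV[R]_L :=
  \sum_(i < n) w i *: T (x i).

Definition dual_objective f T n (x : 'I_n -> 'rV[R]_K) (q : 'I_n -> R)
    (lam : 'rV[R]_L) : R :=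
  inner lam (vexpect f T) -
  ln (\sum_(i < n) q i * expR (inner lam (T (x i)))).

Definition is_unique_maximizer (A : Type) (F : A -> R) (a : A) : Prop :=
  (forall b, F b <= F a) /\ (forall a', (forall b, F b <= F a') -> a' = a).

Definition tilt T n (x : 'I_n -> 'rV[R]_K) (q : 'I_n -> R) (lam : 'rV[R]_L)
    (i : 'I_n) : R :=
  q i * expR (inner lam (T (x i))) /
  \sum_(j < n) q j * expR (inner lam (T (x j))).

Definition err f n (x : 'I_n -> 'rV[R]_K) (w : 'I_n -> R) h : R :=
  `|expect f h - dexpect x w h|.

Definition verr f n (x : 'I_n -> 'rV[R]_K) (w : 'I_n -> R) T : R :=
  enorm (vexpect f T - dvexpect x w T).

Definition C_alpha f T (alpha : R) : \bar R :=
  ereal_inf [set (\int[lebesgue_rV K]_y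
      (f y * Num.max 0 (Num.min (inner lam (T y - vexpect f T)) alpha) ^+ 2)%:E)%E
    | lam in [set lam : 'rV[R]_L | enorm lam = 1]].

Definition C_infty f T : \bar R := lim (C_alpha f T alpha @[alpha --> +oo%R]).

End discretization.

(* Main.v *)
Require Import Defs.
From mathcomp Require Import all_boot all_order all_algebra.
From mathcomp Require Import all_classical all_reals all_analysis.
From mathcomp Require Import measurable_realfun.
From mathcomp Require Import ring lra.

(** Write D_i = T(x_i) - Tbar for the centred moments at the grid points and
    Z(l) = sum_i q_i exp<l, D_i>.  The dual objective equals -log Z, so
    lambda_M minimises Z; this gives everything needed about P_M.

    - Stationarity of Z at lambda_M says that P_M has the exact moments Tbar
      ([tilt_moment]).  Hence replacing g by the residual h = g - b does not
      change the error of P_M ([err_residual]), and the error of P_M at h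
      exceeds that of Q_M by at most ||h|| * sum_i |p_i - q_i|
      ([err_le_reweighted]).

    - The total variation distance is controlled through the Hellinger
      distance: since sum_i sqrt(p_i q_i) = Z(lambda_M / 2) / sqrt(Z(lambda_M))
      and Z(lambda_M / 2) >= Z(lambda_M) by minimality, one gets
      (sum_i |p_i - q_i|)^2 <= 4 (1 - Z(lambda_M)) ([tilt_dist_le]).

    - From e^t >= 1 + t + max(0, t)^2 / 2 and Cauchy-Schwarz,
      Z(l) >= 1 - ||l|| E + C ||l||^2 / 2 >= 1 - E^2 / (2 C), where E is the
      moment error of Q_M, provided that sum_i q_i max(0, <l, D_i>)^2 >= C
      for all unit vectors l ([partition_fun_ge]).  Together with the previous
      point, (sum_i |p_i - q_i|)^2 <= 2 E^2 / C, whence the bound 2 E / sqrt C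
      of [tilt_dist_le_verr].

    - That proviso holds for all large M ([near_pos_part_moment_ge]).  Since
      C < C_infty, some truncation level a has C < C_a.  For a fixed unit
      vector the truncated moment under Q_M converges to an integral which is
      at least C_a; compactness of the sphere makes this uniform.  Weak
      convergence does not bound the Q_M-mass carried far away, where T may
      be large, so the integrand is multiplied by a cutoff that equals 1 on
      the support of f and vanishes where T - Tbar is large: it is then
      Lipschitz in the direction, uniformly in x. *)

Set Implicit Arguments.
Unset Strict Implicit.
Unset Printing Implicit Defensive.

Import Order.TTheory GRing.Theory Num.Theory.
Import numFieldNormedType.Exports.

Local Open Scope classical_set_scope.
Local Open Scope ring_scope.

(** * Euclidean inner product and norm *)

Section inner_product.
Variables (R : realType) (n : nat).
Implicit Types u v w : 'rV[R]_n.

Lemma innerC u v : inner u v = inner v u.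
Proof. by apply: eq_bigr => i _; rewrite mulrC. Qed.

Lemma innerDr u v w : inner u (v + w) = inner u v + inner u w.
Proof. by rewrite -big_split/=; apply: eq_bigr => i _; rewrite mxE mulrDr. Qed.

Lemma innerZr u a v : inner u (a *: v) = a * inner u v.
Proof.
by rewrite [RHS]big_distrr/=; apply: eq_bigr => i _; rewrite mxE mulrCA.
Qed.

Lemma innerNr u v : inner u (- v) = - inner u v.
Proof. by rewrite -scaleN1r innerZr mulN1r. Qed.

Lemma innerBr u v w : inner u (v - w) = inner u v - inner u w.
Proof. by rewrite innerDr innerNr. Qed.

Lemma innerZl a u v : inner (a *: u) v = a * inner u v.
Proof. by rewrite innerC innerZr innerC. Qed.

Lemma innerDl u v w : inner (u + v) w = inner u w + inner v w.
Proof. by rewrite innerC innerDr !(innerC w). Qed.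

Lemma inner_delta i v : inner (delta_mx 0 i) v = v 0 i.
Proof.
rewrite /inner (bigD1 i)//= big1 ?addr0; first by rewrite mxE !eqxx mul1r.
by move=> j ji; rewrite mxE (negPf ji) andbF mul0r.
Qed.

Lemma inner_sumr (I : finType) u (F : I -> 'rV[R]_n) :
  inner u (\sum_i F i) = \sum_i inner u (F i).
Proof.
rewrite exchange_big/=; apply: eq_bigr => j _.
by rewrite summxE big_distrr.
Qed.

Lemma inner_ge0 u : 0 <= inner u u.
Proof. by apply: sumr_ge0 => i _; rewrite -expr2 sqr_ge0. Qed.

Lemma enorm_ge0 u : 0 <= enorm u.
Proof. exact: sqrtr_ge0. Qed.

Lemma sqr_enorm u : enorm u ^+ 2 = inner u u.
Proof. exact/sqr_sqrtr/inner_ge0. Qed.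

Lemma normr_coord_le_enorm u i : `|u 0 i| <= enorm u.
Proof.
rewrite -ler_sqr ?nnegrE ?enorm_ge0// sqr_enorm real_normK ?num_real//.
rewrite /inner (bigD1 i)//= -expr2 lerDl.
by apply: sumr_ge0 => j _; rewrite -expr2 sqr_ge0.
Qed.

Lemma enormZ a u : enorm (a *: u) = `|a| * enorm u.
Proof.
by rewrite /enorm innerZl innerZr mulrA -expr2 sqrtrM ?sqr_ge0// sqrtr_sqr.
Qed.

Lemma continuous_coord (S : topologicalType) (F : S -> 'rV[R]_n) i :
  continuous F -> continuous (fun y => F y 0 i).
Proof.
move=> cF y.
have cc : continuous (fun v : 'rV[R]_n => v 0 i) by exact: coord_continuous.
exact: (@continuous_comp _ _ _ F (fun v : 'rV[R]_n => v 0 i) y (cF y) (cc _)).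
Qed.

Lemma continuous_inner (S : topologicalType) (F G : S -> 'rV[R]_n) :
  continuous F -> continuous G -> continuous (fun y => inner (F y) (G y)).
Proof.
move=> cF cG; apply: continuous_big => [|i _]; first exact: add_continuous.
by move=> y; apply: cvgM; apply: continuous_coord.
Qed.

End inner_product.

(** Discriminant argument for the quadratic form
    (s, t) |-> sum_i w_i (s a_i - t b_i)^2.  The weights spare the square
    roots sqrt(q_i) in [tilt_dist_le]. *)
Lemma weighted_CauchySchwarz (R : realType) n (w a b : 'I_n -> R) :
  (forall i, 0 <= w i) ->
  (\sum_i w i * (a i * b i)) ^+ 2 <=
  (\sum_i w i * a i ^+ 2) * (\sum_i w i * b i ^+ 2).
Proof.
move=> w0.
set A := \sum_i w i * a i ^+ 2; set B := \sum_i w i * b i ^+ 2.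
set P := \sum_i _.
have sum0 (F : 'I_n -> R) : 0 <= \sum_i w i * F i ^+ 2.
  by apply: sumr_ge0 => i _; rewrite mulr_ge0 ?sqr_ge0.
have quad s t : 0 <= s ^+ 2 * A - 2 * s * t * P + t ^+ 2 * B.
  have := sum0 (fun i => s * a i - t * b i); congr (_ <= _).
  rewrite /A /B /P !big_distrr/= -sumrB -big_split/=.
  by apply: eq_bigr => i _; ring.
have [B0|B0] := eqVneq B 0; last first.
  have Bp : 0 < B by rewrite lt_neqAle eq_sym B0 sum0.
  (* for fixed s the form is minimal at t = s P / B *)
  rewrite -subr_ge0 -(pmulr_rge0 _ Bp); have := quad B P; congr (_ <= _).
  by ring.
have P0 : P = 0.
  rewrite /P big1 // => i _.
  have /eqP := B0; rewrite psumr_eq0 => [|j _]; last first.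
    by rewrite mulr_ge0 ?sqr_ge0.
  move=> /allP/(_ i (mem_index_enum _)) /=.
  by rewrite mulf_eq0 sqrf_eq0 => /orP[/eqP->|/eqP->]; rewrite ?mulr0 ?mul0r.
by rewrite P0 B0 expr0n/= mulr0.
Qed.

Lemma inner_le_enorm (R : realType) n (u v : 'rV[R]_n) :
  `|inner u v| <= enorm u * enorm v.
Proof.
rewrite -ler_sqr ?nnegrE ?mulr_ge0 ?enorm_ge0// exprMn !sqr_enorm.
rewrite real_normK ?num_real//.
have := @weighted_CauchySchwarz R n (fun=> 1) (u 0) (v 0) (fun=> ler01).
by congr (_ ^+ 2 <= _ * _); apply: eq_bigr => i _; rewrite mul1r.
Qed.

(** * Exponential tilting of a finite distribution *)

(** For t >= 0 the gap between the two sides has derivative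
    exp t - (1 + t) >= 0; for t < 0 the quadratic term is absent. *)
Lemma quadratic_le_expR (R : realType) (t : R) :
  1 + t + 2^-1 * Num.max 0 t ^+ 2 <= expR t.
Proof.
have [t0|t0] := leP 0 t; last first.
  by rewrite expr0n/= mulr0 addr0 expR_ge1Dx.
pose h (s : R) : R := expR s - (1 + s + 2^-1 * s ^+ 2).
have dh (s : R) : is_derive s (1 : R) h (expR s - (1 + s)).
  apply: is_derive_eq.
  by rewrite /GRing.scale/=; field.
suff : h 0 <= h t by rewrite /h expR0 expr0n/= mulr0; lra.
apply: (@ger0_derive1_ndecr _ h 0 t) => //.
- move=> s _; rewrite derive1E (@derive_val _ _ _ _ _ _ _ (dh s)) subr_ge0.
  exact: expR_ge1Dx.
- apply: continuous_subspaceT => s; apply: differentiable_continuous.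
  by apply/derivable1_diffP; have [] := dh s.
Qed.

Section partition_function.
Variables (R : realType) (n L : nat) (q : 'I_n -> R) (D : 'I_n -> 'rV[R]_L).
Hypothesis q_distr : is_distribution q.

Definition partition_fun (l : 'rV[R]_L) : R :=
  \sum_(i < n) q i * expR (inner l (D i)).

Let q_ge0 i : 0 <= q i. Proof. exact: q_distr.1. Qed.

Lemma partition_fun0 : partition_fun 0 = 1.
Proof.
rewrite -q_distr.2; apply: eq_bigr => i _.
by rewrite -(scale0r (0 : 'rV[R]_L)) innerZl mul0r expR0 mulr1.
Qed.

Lemma distr_gt0 : exists i, 0 < q i.
Proof.
apply: contrapT => /forallNP h.
have /eqP := q_distr.2; rewrite big1 ?(eq_sym 0) ?oner_eq0// => i _.
by apply/le_anti; rewrite q_ge0 andbT leNgt; apply/negP/h.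
Qed.

Lemma partition_fun_gt0 l : 0 < partition_fun l.
Proof.
have [i qi] := distr_gt0.
rewrite /partition_fun (bigD1 i)//= ltr_wpDr// ?mulr_gt0 ?expR_gt0//.
by apply: sumr_ge0 => j _; rewrite mulr_ge0 ?expR_ge0.
Qed.

(** First-order condition: t |-> Z(l + t e_k) is minimal at t = 0 for each
    coordinate k. *)
Lemma min_partition_fun_moment0 l :
  (forall l', partition_fun l <= partition_fun l') ->
  \sum_i (q i * expR (inner l (D i))) *: D i = 0.
Proof.
move=> lmin; apply/rowP => k; rewrite summxE mxE.
pose h (i : 'I_n) (t : R) : R :=
  q i * expR (inner l (D i) + t * D i 0 k).
have hE t : (\sum_(i < n) h i) t = partition_fun (l + t *: delta_mx 0 k).
  rewrite fct_sumE; apply: eq_bigr => i _.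
  by rewrite /h innerDl innerZl inner_delta.
have dh (i : 'I_n) (t : R) : is_derive t (1 : R) (h i) (h i t * D i 0 k).
  have dlin : is_derive t (1 : R) (fun s : R => inner l (D i) + s * D i 0 k) (D i 0 k).
    apply: is_derive_eq.
    by rewrite add0r mul1r scaler0 add0r /GRing.scale/= mulr1.
  have := is_derive1_comp (is_derive_expR _) dlin.
  move=> /(is_deriveZ (q i)) H.
  by apply: (is_derive_eq H); rewrite /h /GRing.scale/= mulrA.
have dsum t := is_derive_sum (fun i => dh i t).
have min0 : is_derive (0 : R) (1 : R) (\sum_(i < n) h i) 0.
  apply: (@derive1_at_min _ _ (-1) 1) => [|t _||t _].
  - lra.
  - by have [] := dsum t.
  - by rewrite in_itv/=; apply/andP; split; lra.
  - by rewrite !hE scale0r addr0.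
have := @derive_val _ _ _ _ _ _ _ min0.
rewrite (@derive_val _ _ _ _ _ _ _ (dsum 0)) => sum0.
rewrite -[RHS]sum0; apply: eq_bigr => i _.
by rewrite mxE /h mul0r addr0.
Qed.

(** Let p_i be the weights q_i exp<l, D_i> / Z(l), z = sqrt(Z(l)) and
    a_i = exp(<l, D_i> / 2) / z, so that p_i = q_i a_i^2 and
    p_i - q_i = q_i (a_i - 1) (a_i + 1).  By Cauchy-Schwarz with weights q_i the
    left-hand side is at most (2 - 2 w) (2 + 2 w) = 4 (1 - w^2), where
    w = sum_i q_i a_i = Z(l / 2) / z.  Minimality gives Z(l / 2) >= Z(l) = z^2,
    that is w >= z. *)
Lemma tilt_dist_le l :
  (forall l', partition_fun l <= partition_fun l') ->
  (\sum_i `|q i * expR (inner l (D i)) / partition_fun l - q i|) ^+ 2 <=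
  4 * (1 - partition_fun l).
Proof.
move=> lmin; pose p i := q i * expR (inner l (D i)) / partition_fun l.
pose Z := partition_fun l.
have Z0 : 0 < Z := partition_fun_gt0 l.
set z := Num.sqrt Z.
have zz : z ^+ 2 = Z by rewrite sqr_sqrtr// ltW.
have z0 : 0 < z by rewrite sqrtr_gt0.
pose e i := expR (inner (2^-1 *: l) (D i)).
have ee i : expR (inner l (D i)) = e i ^+ 2.
  rewrite /e expr2 -expRD innerZl; congr expR; lra.
pose a i := e i / z.
have pE i : p i = q i * a i ^+ 2.
  by rewrite /p ee /a expr_div_n zz (mulrA _ (_ ^+ 2)).
pose W := partition_fun (2^-1 *: l).
have WZ : Z <= W := lmin _.
have sumq : \sum_i q i = 1 := q_distr.2.
have suma2 : \sum_i q i * a i ^+ 2 = 1.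
  rewrite -(@divff _ Z) ?gt_eqF// /Z /partition_fun big_distrl/=.
  by apply: eq_bigr => i _; rewrite -pE.
have suma : \sum_i q i * a i = W / z.
  by rewrite /W /partition_fun big_distrl/=; apply: eq_bigr => i _; rewrite mulrA.
have dist_eq : \sum_i `|p i - q i| = \sum_i q i * (`|a i - 1| * (a i + 1)).
  apply: eq_bigr => i _; rewrite pE -[X in _ - X]mulr1 -mulrBr normrM.
  rewrite ger0_norm; last exact: q_ge0.
  congr (_ * _); rewrite -[1 in LHS](expr1n _ 2) subr_sqr normrM.
  by rewrite (ger0_norm (_ : 0 <= a i + 1))// addr_ge0// divr_ge0 ?expR_ge0 ?ltW.
rewrite -/Z dist_eq; apply: (le_trans (weighted_CauchySchwarz _ _ q_ge0)).
have hell : \sum_i q i * `|a i - 1| ^+ 2 = 2 - 2 * (W / z).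
  transitivity (\sum_i q i * a i ^+ 2 - 2 * (\sum_i q i * a i) + \sum_i q i).
    rewrite big_distrr/= -sumrB -big_split/=; apply: eq_bigr => i _.
    by rewrite real_normK ?num_real//; ring.
  by rewrite suma2 suma sumq; ring.
have plus : \sum_i q i * (a i + 1) ^+ 2 = 2 + 2 * (W / z).
  transitivity (\sum_i q i * a i ^+ 2 + 2 * (\sum_i q i * a i) + \sum_i q i).
    rewrite big_distrr/= -!big_split/=; apply: eq_bigr => i _.
    by ring.
  by rewrite suma2 suma sumq; ring.
rewrite hell plus.
have Wz : z <= W / z by rewrite ler_pdivlMr// -expr2 zz.
nra.
Qed.

(** Expanding the exponential to second order bounds Z(l) below by a
    quadratic polynomial in ||l||, whose minimum is the left-hand side. *)
Lemma partition_fun_ge l (C : R) :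
  0 < C ->
  C * enorm l ^+ 2 <= \sum_i q i * Num.max 0 (inner l (D i)) ^+ 2 ->
  1 - enorm (\sum_i q i *: D i) ^+ 2 / (2 * C) <= partition_fun l.
Proof.
move=> C0 Cl; set E := enorm (\sum_i _); set t := enorm l in Cl *.
have lE : - (t * E) <= inner l (\sum_i q i *: D i).
  by have := inner_le_enorm l (\sum_i q i *: D i); rewrite ler_norml => /andP[].
have lower : 1 + inner l (\sum_i q i *: D i) +
    2^-1 * \sum_i q i * Num.max 0 (inner l (D i)) ^+ 2 <= partition_fun l.
  rewrite -[X in X + inner _ _]q_distr.2 inner_sumr big_distrr/= -!big_split/=.
  apply: ler_sum => i _; rewrite innerZr.
  have := ler_wpM2l (q_ge0 i) (quadratic_le_expR (inner l (D i))).
  by apply: le_trans; rewrite le_eqVlt; apply/orP; left; apply/eqP; ring.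
apply: le_trans lower.
apply: (@le_trans _ _ (1 - t * E + 2^-1 * (C * t ^+ 2))); last lra.
have -> : E ^+ 2 / (2 * C) = t * E - 2^-1 * (C * t ^+ 2) + (E - C * t) ^+ 2 / (2 * C).
  by field; rewrite gt_eqF.
have : 0 <= (E - C * t) ^+ 2 / (2 * C) by rewrite divr_ge0 ?sqr_ge0// mulr_ge0 ?ltW.
lra.
Qed.

End partition_function.

(** * Continuity and compactness *)

Section continuous_arithmetic.
Variables (R : realType) (S : topologicalType).
Implicit Types F G : S -> R.

Lemma continuous_sub (V : normedModType R) (F G : S -> V) :
  continuous F -> continuous G -> continuous (fun y => F y - G y).
Proof. by move=> cF cG y; apply: cvgB; [exact: cF|exact: cG]. Qed.

Lemma continuous_mul F G :
  continuous F -> continuous G -> continuous (fun y => F y * G y).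
Proof. by move=> cF cG y; apply: cvgM; [exact: cF|exact: cG]. Qed.

Lemma continuous_const (V : topologicalType) (c : V) :
  continuous (fun _ : S => c).
Proof. by move=> y; exact: cvg_cst. Qed.

Lemma continuous_compose (U V : topologicalType) (F : S -> U) (G : U -> V) :
  continuous F -> continuous G -> continuous (fun y => G (F y)).
Proof. by move=> cF cG y; exact: (continuous_comp (cF y) (cG _)). Qed.

Lemma continuous_lincomb m (c : 'I_m -> R) (F : 'I_m -> S -> R) :
  (forall i, continuous (F i)) -> continuous (fun y => \sum_i c i * F i y).
Proof.
move=> cF; apply: continuous_big => [|i _]; first exact: add_continuous.
by apply: continuous_mul => //; exact: continuous_const.
Qed.

End continuous_arithmetic.

Lemma continuous_enorm (R : realType) n : continuous (@enorm R n).
Proof.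
move=> u; apply: (@continuous_comp _ _ _ (fun u => inner u u) Num.sqrt).
  by apply: continuous_inner => v; exact: cvg_id.
exact: sqrt_continuous.
Qed.

Lemma compact_unit_sphere (R : realType) n :
  compact [set u : 'rV[R]_n | enorm u = 1].
Proof.
apply: (@subclosed_compact _ _
    [set v : 'rV[R]_n | forall i, `[-1, 1]%classic (v ord0 i)]).
- apply: (@preimage_closed _ _ (@enorm R n) [set t | t = 1]).
    by move=> u _; exact: continuous_enorm.
  exact: closed_eq.
- apply: (@rV_compact R n (fun=> `[-1, 1]%classic)) => i.
  exact: segment_compact.
- move=> u /= u1 i; have := normr_coord_le_enorm u i.
  by rewrite u1 in_itv/= ler_norml.
Qed.

(** * Expectation under a density *)

Section density.
Variables (R : realType) (K : nat) (f : 'rV[R]_K -> R).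
Hypothesis f_density : is_density f.
Implicit Type h : 'rV[R]_K -> R.

Let mf : measurable_fun setT f. Proof. by case: f_density. Qed.
Let f_ge0 y : 0 <= f y. Proof. by case: f_density. Qed.

Lemma integrable_density : (lebesgue_rV K).-integrable setT (EFin \o f).
Proof.
apply/integrableP; split; first exact/measurable_EFinP.
under eq_integral do rewrite /= ger0_norm//.
by case: f_density => _ _ ->; exact: ltry.
Qed.

(** A bound on the support is enough: the integrand vanishes elsewhere.  This
    matters for the components of T, which may be unbounded on the whole
    space. *)
Lemma integrable_density_mul h B : continuous h ->
  (forall y, supp f y -> `|h y| <= B) ->
  (lebesgue_rV K).-integrable setT (EFin \o (fun y => f y * h y)).
Proof.
move=> ch hB.
have mfh : measurable_fun setT (fun y => f y * h y).
  by apply: measurable_funM => //; exact: continuous_measurable_rV.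
have iBf : (lebesgue_rV K).-integrable setT (fun y => (B%:E * (f y)%:E)%E).
  exact: integrableZl (integrable_density).
apply: le_integrable iBf => //; first exact/measurable_EFinP.
move=> y _ /=; rewrite lee_fin [B * _]mulrC !normrM.
have [->|fy] := eqVneq (f y) 0; first by rewrite normr0 !mul0r.
rewrite ler_wpM2l// (le_trans _ (ler_norm B))// hB//.
exact: subset_closure.
Qed.

Lemma expectD h1 h2 B1 B2 : continuous h1 -> continuous h2 ->
  (forall y, supp f y -> `|h1 y| <= B1) ->
  (forall y, supp f y -> `|h2 y| <= B2) ->
  expect f (fun y => h1 y + h2 y) = expect f h1 + expect f h2.
Proof.
move=> c1 c2 b1 b2.
rewrite /expect -RintegralD//; last 2 first.
- exact: integrable_density_mul b1.
- exact: integrable_density_mul b2.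
by congr (Rintegral _ _ _); apply/funext => y; rewrite mulrDr.
Qed.

Lemma expectZ a h B : continuous h -> (forall y, supp f y -> `|h y| <= B) ->
  expect f (fun y => a * h y) = a * expect f h.
Proof.
move=> ch b; rewrite /expect -RintegralZl//; last first.
  exact: integrable_density_mul b.
by congr (Rintegral _ _ _); apply/funext => y; rewrite mulrCA.
Qed.

Lemma expect_lincomb m (c : 'I_m -> R) (F : 'I_m -> 'rV[R]_K -> R) :
  (forall i, continuous (F i)) ->
  (forall i, exists B, forall y, supp f y -> `|F i y| <= B) ->
  expect f (fun y => \sum_i c i * F i y) = \sum_i c i * expect f (F i).
Proof.
move=> cF bF.
have intF i : (lebesgue_rV K).-integrable setT
    (EFin \o (fun y => f y * (c i * F i y))).
  have [B FB] := bF i; apply: (@integrable_density_mul _ (`|c i| * B)).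
    by apply: continuous_mul => //; exact: continuous_const.
  by move=> y fy; rewrite normrM ler_wpM2l// FB.
rewrite /expect.
transitivity (\int[lebesgue_rV K]_y (\sum_i f y * (c i * F i y)))%R.
  by congr (Rintegral _ _ _); apply/funext => y; rewrite big_distrr.
transitivity (\sum_i \int[lebesgue_rV K]_y (f y * (c i * F i y)))%R.
  rewrite /Rintegral; under eq_integral do rewrite -sumEFin.
  rewrite integral_sum// -sum_fine// => i _.
  exact: (integrable_fin_num measurableT (intF i)).
by apply: eq_bigr => i _; have [B FB] := bF i; exact: expectZ (cF i) FB.
Qed.

End density.

(** * Truncation and cutoff *)

Definition clip (R : realType) (alpha t : R) : R :=
  Num.max 0 (Num.min t alpha).

Section clip.
Variables (R : realType) (alpha : R).
Implicit Types s t : R.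

Lemma clip_ge0 t : 0 <= clip alpha t.
Proof. by rewrite /clip le_max lexx. Qed.

Lemma clip_le t : clip alpha t <= `|alpha|.
Proof. by rewrite /clip ge_max normr_ge0 ge_min ler_norm orbT. Qed.

Lemma clip_le_pos t : clip alpha t <= Num.max 0 t.
Proof.
rewrite /clip ge_max !le_max lexx/=; apply/orP; right.
by rewrite ge_min lexx.
Qed.

Lemma clip_homo t : {homo clip (R := R) ^~ t : a b / a <= b}.
Proof.
move=> a b ab; rewrite /clip ge_max !le_max lexx/=; apply/orP; right.
by rewrite le_min !ge_min lexx ab orbT.
Qed.

Lemma sqr_clip_lipschitz s t :
  `|clip alpha s ^+ 2 - clip alpha t ^+ 2| <= 2 * `|alpha| * `|s - t|.
Proof.
have lip : `|clip alpha s - clip alpha t| <= `|s - t|.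
  rewrite /clip; case: (leP s alpha) => ?; case: (leP t alpha) => ?;
  case: (leP 0 s) => ?; case: (leP 0 t) => ?; case: (leP 0 alpha) => ?;
  rewrite ler_norml; case: (ler0P (s - t)) => ?; lra.
rewrite subr_sqr normrM mulrC ler_pM// ger0_norm; last first.
  by rewrite addr_ge0 ?clip_ge0.
by rewrite mulr_natl mulr2n lerD ?clip_le.
Qed.

Lemma continuous_clip : continuous (clip alpha).
Proof.
move=> t; apply: (@max_fun_continuous _ R R (fun=> 0)).
  by move=> ?; exact: cvg_cst.
by apply: min_fun_continuous => [?|?]; [exact: cvg_id|exact: cvg_cst].
Qed.

End clip.

(** A piecewise linear bump: 1 up to B, and 0 from B + 1 on. *)
Definition cutoff (R : realType) (B t : R) : R :=
  Num.max 0 (1 - Num.max 0 (t - B)).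

Section cutoff.
Variables (R : realType) (B : R).
Implicit Type t : R.

Lemma cutoff_ge0 t : 0 <= cutoff B t.
Proof. by rewrite /cutoff le_max lexx. Qed.

Lemma cutoff_le1 t : cutoff B t <= 1.
Proof. by rewrite /cutoff ge_max ler01 gerBl le_max lexx. Qed.

Lemma cutoff_eq1 t : t <= B -> cutoff B t = 1.
Proof.
by move=> tB; rewrite /cutoff (max_l (_ : t - B <= 0)) ?subr_le0// subr0 max_r.
Qed.

Lemma cutoff_eq0 t : B + 1 <= t -> cutoff B t = 0.
Proof.
move=> tB; rewrite /cutoff (max_r (_ : 0 <= t - B)) ?max_l//; lra.
Qed.

Lemma continuous_cutoff : continuous (cutoff B).
Proof.
apply: (@max_fun_continuous _ R R (fun=> 0)); first exact: continuous_const.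
apply: continuous_sub; first exact: continuous_const.
apply: (@max_fun_continuous _ R R (fun=> 0)); first exact: continuous_const.
by apply: continuous_sub => [?|]; [exact: cvg_id|exact: continuous_const].
Qed.

End cutoff.

(** * Uniform lower bound of the truncated moments on the sphere *)

Section truncated_moment.
Variables (R : realType) (K L : nat).
Variables (f : 'rV[R]_K -> R) (T : 'rV[R]_K -> 'rV[R]_L).
Hypotheses (f_density : is_density f) (T_cont : continuous T).
Hypothesis T_bounded : forall l, [bounded T y 0 l | y in supp f].

Let mf : measurable_fun setT f. Proof. by case: f_density. Qed.
Let f_ge0 y : 0 <= f y. Proof. by case: f_density. Qed.
Let dev y := T y - vexpect f T.

Lemma coord_bounded l : exists B, forall y, supp f y -> `|T y 0 l| <= B.
Proof.
have [B [_ BT]] := T_bounded l; exists (B + 1) => y.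
by apply: BT; rewrite ltrDl.
Qed.

Lemma continuous_dev : continuous dev.
Proof. by apply: continuous_sub => //; exact: continuous_const. Qed.

Lemma continuous_inner_dev (l : 'rV[R]_L) : continuous (fun y => inner l (dev y)).
Proof.
apply: continuous_inner; last exact: continuous_dev.
exact: continuous_const.
Qed.

Lemma sqr_dev_bounded :
  exists B, forall y, supp f y -> inner (dev y) (dev y) <= B.
Proof.
pose Bl l := projT1 (cid (coord_bounded l)).
have BlP l y : supp f y -> `|T y 0 l| <= Bl l.
  by move: y; rewrite /Bl; case: cid.
exists (\sum_l (Bl l + `|vexpect f T 0 l|) ^+ 2) => y fy.
apply: ler_sum => l _; rewrite -expr2 -(@real_normK _ (dev y 0 l)) ?num_real//.
rewrite lerXn2r ?nnegrE ?addr_ge0 ?(le_trans _ (BlP l y fy))// /dev !mxE.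
by apply: (le_trans (ler_normB _ _)); rewrite lerD2r BlP.
Qed.

Let measurable_integrand (l : 'rV[R]_L) a : measurable_fun setT
  (fun y => (f y * clip a (inner l (dev y)) ^+ 2)%:E).
Proof.
apply/measurable_EFinP/measurable_funM => //.
apply: measurable_funX; apply: continuous_measurable_rV.
by apply: continuous_compose; [exact: continuous_inner_dev|exact: continuous_clip].
Qed.

Lemma C_alpha_nondecreasing : {homo C_alpha f T : a b / a <= b >-> (a <= b)%E}.
Proof.
move=> a b ab; apply: le_ereal_inf_tmp => _ [l l1 <-].
apply: ge_ereal_inf; eexists; first by exists l.
apply: ge0_le_integral => //.
- by move=> y _; rewrite lee_fin mulr_ge0 ?sqr_ge0.
- exact: measurable_integrand.
- exact: measurable_integrand.
- move=> y _; rewrite lee_fin ler_wpM2l// lerXn2r ?nnegrE ?clip_ge0//.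
  exact: clip_homo.
Qed.

(** C_alpha is nondecreasing in alpha, so its limit at infinity is its
    supremum. *)
Lemma C_alpha_gt C : (C%:E < C_infty f T)%E -> exists a, (C%:E < C_alpha f T a)%E.
Proof.
rewrite /C_infty (cvg_lim _ (nondecreasing_cvge C_alpha_nondecreasing))//.
by move=> /ereal_sup_gt[_ [a _ <-] Ca]; exists a.
Qed.

(** The integrand of C_alpha multiplied by a cutoff in ||T - Tbar||^2. *)
Definition truncated_square a B (l : 'rV[R]_L) y : R :=
  cutoff B (inner (dev y) (dev y)) * clip a (inner l (dev y)) ^+ 2.

Lemma truncated_square_ge0 a B l y : 0 <= truncated_square a B l y.
Proof. by rewrite mulr_ge0 ?cutoff_ge0 ?sqr_ge0. Qed.

Lemma truncated_square_le a B l y :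
  truncated_square a B l y <= Num.max 0 (inner l (dev y)) ^+ 2.
Proof.
apply: (@le_trans _ _ (clip a (inner l (dev y)) ^+ 2)).
  by rewrite ler_piMl ?sqr_ge0 ?cutoff_le1.
by rewrite lerXn2r ?nnegrE ?clip_ge0 ?clip_le_pos// le_max lexx.
Qed.

Lemma truncated_square_le_bound a B l y : truncated_square a B l y <= `|a| ^+ 2.
Proof.
apply: (@le_trans _ _ (clip a (inner l (dev y)) ^+ 2)).
  by rewrite ler_piMl ?sqr_ge0 ?cutoff_le1.
by rewrite lerXn2r ?nnegrE ?clip_ge0 ?clip_le.
Qed.

Lemma continuous_truncated_square a B l : continuous (truncated_square a B l).
Proof.
apply: continuous_mul.
  apply: continuous_compose; last exact: continuous_cutoff.
  by apply: continuous_inner; exact: continuous_dev.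
under [X in continuous X]funext do rewrite expr2.
have cc : continuous (fun y => clip a (inner l (dev y))).
  by apply: continuous_compose; [exact: continuous_inner_dev|exact: continuous_clip].
exact: continuous_mul.
Qed.

(** Where the cutoff is nonzero, ||T - Tbar|| <= sqrt (B + 1); this is what
    makes the Lipschitz constant independent of the point y. *)
Lemma truncated_square_lipschitz a B l l' y :
  `|truncated_square a B l y - truncated_square a B l' y| <=
  2 * `|a| * Num.sqrt (B + 1) * enorm (l - l').
Proof.
rewrite /truncated_square -mulrBr normrM ger0_norm ?cutoff_ge0//.
have [By|yB] := leP (B + 1) (inner (dev y) (dev y)).
  by rewrite cutoff_eq0// mul0r !mulr_ge0 ?sqrtr_ge0 ?enorm_ge0.
apply: (le_trans (ler_piMl _ (cutoff_le1 _ _))) => //.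
apply: (le_trans (sqr_clip_lipschitz _ _ _)).
rewrite -[leRHS]mulrA ler_wpM2l ?mulr_ge0//.
rewrite !(innerC _ (dev y)) -innerBr.
apply: (le_trans (inner_le_enorm _ _)).
by rewrite ler_wpM2r ?enorm_ge0// ler_wsqrtr// ltW.
Qed.

(** The cutoff is 1 wherever f is nonzero, so it leaves the integral defining
    C_alpha unchanged. *)
Lemma C_alpha_le_expect a B l :
  (forall y, supp f y -> inner (dev y) (dev y) <= B) -> enorm l = 1 ->
  (C_alpha f T a <= (expect f (truncated_square a B l))%:E)%E.
Proof.
move=> devB l1.
apply: ge_ereal_inf; eexists; first by exists l.
have int : (lebesgue_rV K).-integrable setT
    (EFin \o (fun y => f y * truncated_square a B l y)).
  apply: (@integrable_density_mul _ _ _ f_density _ (`|a| ^+ 2)).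
    exact: continuous_truncated_square.
  move=> y _; rewrite ger0_norm ?truncated_square_ge0//.
  exact: truncated_square_le_bound.
rewrite /expect /Rintegral fineK; last exact: (integrable_fin_num measurableT int).
rewrite le_eqVlt; apply/orP; left; apply/eqP; apply: eq_integral => y _.
have [->|fy] := eqVneq (f y) 0; first by rewrite !mul0r.
by rewrite /truncated_square cutoff_eq1 ?mul1r// devB//; exact: subset_closure.
Qed.

(** Around each unit vector l, the margin between C and the limit of the
    truncated moments is spent half on weak convergence at l and half on moving
    to a neighbouring direction; compactness of the sphere concludes. *)
Lemma near_pos_part_moment_ge (N : nat -> nat) (x : forall M, 'I_(N M) -> 'rV[R]_K)
    (q : forall M, 'I_(N M) -> R) (C : R) :
  (forall M, (0 < M)%N -> is_distribution (q M)) ->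
  (forall h : 'rV[R]_K -> R, continuous h -> bounded_fun h ->
    dexpect (x M) (q M) h @[M --> \oo] --> expect f h) ->
  (C%:E < C_infty f T)%E ->
  \forall M \near \oo, forall l, enorm l = 1 ->
    C <= \sum_i q M i * Num.max 0 (inner l (dev (x M i))) ^+ 2.
Proof.
move=> q_distr Q_cvg /C_alpha_gt[a Ca].
have [B devB] := sqr_dev_bounded.
pose F l M := dexpect (x M) (q M) (truncated_square a B l).
suff: \forall M \near \oo, [set l | enorm l = 1] `<=` [set l | C <= F l M].
  move=> nearF; near=> M => l l1.
  have M0 : (0 < M)%N by near: M; exact: nbhs_infty_gt.
  apply: (@le_trans _ _ (F l M)).
    by move: l l1; near: M; exact: nearF.
  apply: ler_sum => i _; apply: ler_wpM2l; first exact: (q_distr M M0).1.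
  exact: truncated_square_le.
apply: (compact_near_coveringP _).1; first exact: compact_unit_sphere.
move=> l l1 /=.
have El : C < expect f (truncated_square a B l).
  by rewrite -lte_fin; exact: lt_le_trans Ca (C_alpha_le_expect _ devB l1).
set E := expect f _ in El.
pose e := (E - C) / 2.
have e0 : 0 < e by rewrite /e; lra.
pose k := 2 * `|a| * Num.sqrt (B + 1).
have nearl : \forall l' \near l, k * enorm (l' - l) < e.
  have ck : continuous (fun l' : 'rV[R]_L => k * enorm (l' - l)).
    apply: continuous_mul; first exact: continuous_const.
    apply: continuous_compose; last exact: continuous_enorm.
    by apply: continuous_sub => [?|]; [exact: cvg_id|exact: continuous_const].
  have := ck l; rewrite /continuous_at subrr.
  have -> : enorm (0 : 'rV[R]_L) = 0.
    by rewrite -(scale0r (0 : 'rV[R]_L)) enormZ normr0 mul0r.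
  by rewrite mulr0 => /cvgr_lt; exact.
have nearM : \forall M \near \oo, (0 < M)%N /\ C + e < F l M.
  near=> M; split; near: M; first exact: nbhs_infty_gt.
  apply: (cvgr_gt E); last by rewrite /e; lra.
  apply: Q_cvg; first exact: continuous_truncated_square.
  exists (`|a| ^+ 2); split=> [|b ab y _ /=]; first exact: num_real.
  rewrite ger0_norm ?truncated_square_ge0//.
  exact: le_trans (truncated_square_le_bound _ _ _ _) (ltW ab).
exists ([set l' | k * enorm (l' - l) < e], [set M | (0 < M)%N /\ C + e < F l M]) => //.
move=> [l' M] /= [kl [M0 CF]].
have [q0 q1] := q_distr M M0.
suff : F l M - F l' M <= k * enorm (l' - l) by lra.
rewrite /F /dexpect -sumrB -[leRHS]mul1r -q1 big_distrl/=.
apply: ler_sum => i _; rewrite -mulrBr ler_wpM2l//.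
apply: (le_trans (ler_norm _)); rewrite distrC.
exact: truncated_square_lipschitz.
Unshelve. all: by end_near. Qed.

End truncated_moment.

(** * The tilted distribution maximising the dual objective *)

Section tilted_distribution.
Variables (R : realType) (K L n : nat).
Variables (f : 'rV[R]_K -> R) (T : 'rV[R]_K -> 'rV[R]_L).
Variables (x : 'I_n -> 'rV[R]_K) (q : 'I_n -> R) (lam : 'rV[R]_L).
Hypothesis q_distr : is_distribution q.
Hypothesis lam_max :
  forall l, dual_objective f T x q l <= dual_objective f T x q lam.

Let dev i := T (x i) - vexpect f T.
Let Z := partition_fun q dev.
Let p := tilt T x q lam.

Lemma partition_fun_shift l : Z l =
  expR (- inner l (vexpect f T)) * \sum_(i < n) q i * expR (inner l (T (x i))).
Proof.
rewrite /Z /partition_fun big_distrr/=; apply: eq_bigr => i _.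
by rewrite innerBr addrC expRD mulrCA.
Qed.

Lemma partition_fun_dual l : Z l = expR (- dual_objective f T x q l).
Proof.
rewrite partition_fun_shift /dual_objective opprB addrC expRD lnK//.
exact: (partition_fun_gt0 (fun i => T (x i)) q_distr).
Qed.

Lemma dual_max_partition_min l : Z lam <= Z l.
Proof. by rewrite !partition_fun_dual ler_expR lerN2. Qed.

Lemma tilt_shift i : p i = q i * expR (inner lam (dev i)) / Z lam.
Proof.
rewrite partition_fun_shift innerBr addrC expRD /p /tilt mulrCA.
by rewrite -mulf_div divff ?mul1r// gt_eqF// expR_gt0.
Qed.

Lemma sum_tilt : \sum_i p i = 1.
Proof.
under eq_bigr do rewrite tilt_shift.
rewrite -big_distrl/= -/(partition_fun q dev lam) divff// gt_eqF//.
exact: partition_fun_gt0.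
Qed.

Lemma tilt_moment : dvexpect x p T = vexpect f T.
Proof.
apply/eqP; rewrite -subr_eq0 -[X in _ - X]scale1r -sum_tilt scaler_suml.
rewrite /dvexpect -sumrB.
transitivity ((Z lam)^-1 *: \sum_i (q i * expR (inner lam (dev i))) *: dev i == 0).
  congr (_ == 0); rewrite scaler_sumr; apply: eq_bigr => i _.
  by rewrite -scalerBr tilt_shift scalerA [in RHS]mulrC.
rewrite (min_partition_fun_moment0 dual_max_partition_min) scaler0.
exact: eqxx.
Qed.

(** The lower bound on the sphere extends to lambda by homogeneity of degree
    two; then [tilt_dist_le] and [partition_fun_ge] bound the square of the
    left-hand side by 4 * E^2 / (2 C), half of (2 E / sqrt C)^2. *)
Lemma tilt_dist_le_verr (C : R) : 0 < C ->
  (forall l, enorm l = 1 ->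
    C <= \sum_i q i * Num.max 0 (inner l (dev i)) ^+ 2) ->
  \sum_i `|p i - q i| <= 2 / Num.sqrt C * verr f x q T.
Proof.
move=> C0 sphere.
have verrE : enorm (\sum_i q i *: dev i) = verr f x q T.
  rewrite /verr -opprB -scaleN1r enormZ normrN1 mul1r; congr enorm.
  rewrite /dvexpect -[X in _ - X]scale1r -q_distr.2 scaler_suml -sumrB.
  by apply: eq_bigr => i _; rewrite scalerBr.
have Clam : C * enorm lam ^+ 2 <=
    \sum_i q i * Num.max 0 (inner lam (dev i)) ^+ 2.
  have [lam0|lam0] := eqVneq (enorm lam) 0.
    rewrite lam0 expr0n/= mulr0; apply: sumr_ge0 => i _.
    by rewrite mulr_ge0 ?sqr_ge0// q_distr.1.
  set t := enorm lam in lam0 *.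
  have t0 : 0 < t by rewrite lt_neqAle eq_sym lam0 enorm_ge0.
  have := sphere (t^-1 *: lam); rewrite enormZ gtr0_norm ?invr_gt0// mulVf//.
  move=> /(_ erefl); rewrite -(ler_pM2r (exprn_gt0 2 t0)) => /le_trans; apply.
  rewrite le_eqVlt; apply/orP; left; apply/eqP.
  rewrite big_distrl/=; apply: eq_bigr => i _.
  rewrite innerZl -mulrA -exprMn maxr_pMl ?mul0r ?ltW//.
  by rewrite mulrAC mulVf// mul1r.
have Zge := partition_fun_ge q_distr C0 Clam.
have := tilt_dist_le q_distr dual_max_partition_min.
rewrite (eq_bigr (fun i => `|p i - q i|)) => [TV|i _]; last by rewrite -tilt_shift.
rewrite verrE in Zge.
rewrite -ler_sqr ?nnegrE; last 2 first.
- by apply: sumr_ge0 => i _; exact: normr_ge0.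
- by rewrite mulr_ge0 ?enorm_ge0// divr_ge0 ?sqrtr_ge0.
apply: (le_trans TV).
rewrite exprMn expr_div_n (sqr_sqrtr (ltW C0)).
have -> : 2 ^+ 2 / C * verr f x q T ^+ 2 =
    8 * (1 - (1 - verr f x q T ^+ 2 / (2 * C))) by field; rewrite gt_eqF.
have Z1 : Z lam <= 1.
  by rewrite -(partition_fun0 dev q_distr) dual_max_partition_min.
rewrite /Z in Z1; lra.
Qed.

End tilted_distribution.

(** * Comparison of the errors *)

Lemma sup_norm_ge (R : realType) K (h : 'rV[R]_K -> R) y :
  bounded_fun h -> `|h y| <= sup_norm h.
Proof.
move=> [B [_ hB]]; apply: ub_le_sup; last by exists y.
by exists (B + 1) => _ [z _ <-]; apply: hB; rewrite ?ltrDl.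
Qed.

Lemma err_le_reweighted (R : realType) K (f : 'rV[R]_K -> R) n
    (x : 'I_n -> 'rV[R]_K) (p q : 'I_n -> R) h s :
  (forall y, `|h y| <= s) ->
  err f x p h <= err f x q h + s * \sum_i `|p i - q i|.
Proof.
move=> hs.
rewrite /err; have -> : expect f h - dexpect x p h =
  (expect f h - dexpect x q h) + (dexpect x q h - dexpect x p h) by ring.
apply: (le_trans (ler_normD _ _)); rewrite lerD2l distrC.
rewrite /dexpect -sumrB big_distrr/=; apply: (le_trans (ler_norm_sum _ _ _)).
apply: ler_sum => i _; rewrite -mulrBl normrM mulrC.
by rewrite ler_wpM2r.
Qed.

(** A linear combination of the components of T has the same mean under f and
    under p, so subtracting it from g leaves the error unchanged. *)
Lemma err_residual (R : realType) (K L : nat) (f : 'rV[R]_K -> R)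
    (T : 'rV[R]_K -> 'rV[R]_L) n (x : 'I_n -> 'rV[R]_K) (p : 'I_n -> R)
    (g : 'rV[R]_K -> R) (beta : 'I_L -> R) s
    (b := fun y => \sum_(l < L) beta l * T y 0 l) :
  is_density f -> continuous T ->
  (forall l, [bounded T y 0 l | y in supp f]) -> continuous g ->
  (forall y, `|g y - b y| <= s) -> dvexpect x p T = vexpect f T ->
  err f x p g = err f x p (fun y => g y - b y).
Proof.
move=> f_density T_cont T_bounded g_cont hs moment.
pose h y := g y - b y.
have gE : g = (fun y => h y + b y) by apply/funext => y; rewrite /h subrK.
have cT l : continuous (fun y => T y 0 l) by exact: continuous_coord.
have cb : continuous b by exact: continuous_lincomb.
have ch : continuous h by exact: continuous_sub.
have bT := coord_bounded T_bounded.
have [Bb bB] : exists B, forall y, supp f y -> `|b y| <= B.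
  exists (\sum_l `|beta l| * projT1 (cid (bT l))) => y fy.
  apply: (le_trans (ler_norm_sum _ _ _)); apply: ler_sum => l _.
  by rewrite normrM ler_wpM2l//; case: cid => B /=; apply.
have expect_g : expect f g = expect f h + expect f b.
  by rewrite {1}gE (@expectD _ _ _ f_density _ _ s Bb ch cb (fun y _ => hs y) bB).
have dexpect_g : dexpect x p g = dexpect x p h + dexpect x p b.
  rewrite /dexpect -big_split/=; apply: eq_bigr => i _.
  by rewrite -mulrDr /h subrK.
have moment_b : expect f b = dexpect x p b.
  rewrite /b expect_lincomb// /dexpect; under [RHS]eq_bigr do rewrite big_distrr/=.
  rewrite exchange_big/=; apply: eq_bigr => l _.
  have := congr1 (fun v : 'rV[R]_L => v 0 l) moment; rewrite mxE => <-.
  rewrite summxE big_distrr/=; apply: eq_bigr => i _.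
  by rewrite mxE mulrCA.
by rewrite /err expect_g dexpect_g moment_b opprD addrACA subrr addr0.
Qed.

Theorem theorem7 (R : realType) (K L : nat)
  (f : 'rV[R]_K -> R) (T : 'rV[R]_K -> 'rV[R]_L)
  (N : nat -> nat) (x : forall M, 'I_(N M) -> 'rV[R]_K)
  (q : forall M, 'I_(N M) -> R) (lambda : nat -> 'rV[R]_L)
  (K_gt0 : (0 < K)%N) (L_gt0 : (0 < L)%N)
  (f_density : is_density f)
  (T_cont : continuous T)
  (x_inj : forall M, (0 < M)%N -> injective (x M))
  (q_distr : forall M, (0 < M)%N -> is_distribution (q M))
  (lambda_max : forall M, (0 < M)%N ->
    is_unique_maximizer (dual_objective f T (x M) (q M)) (lambda M))
  (supp_compact : compact (supp f))
  (T_bounded : forall l, [bounded T y 0 l | y in supp f])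
  (T_indep : affine_independent_on (supp f) T)
  (T_interior : forall M, (0 < M)%N ->
    (convex_hull (T @` range (x M)))° (vexpect f T))
  (Q_cvg : forall h : 'rV[R]_K -> R, continuous h -> bounded_fun h ->
    dexpect (x M) (q M) h @[M --> \oo] --> expect f h)
  (QT_cvg : dvexpect (x M) (q M) T @[M --> \oo] --> vexpect f T)
  (g : 'rV[R]_K -> R) (g_cont : continuous g) (g_bounded : bounded_fun g)
  (beta : 'I_L -> R) :
  let b y := \sum_(l < L) beta l * T y 0 l in
  let s := sup_norm (fun y => g y - b y) in
  let r y := (g y - b y) / s in
  let p M := tilt T (x M) (q M) (lambda M) in
  bounded_fun (fun y => g y - b y) ->
  forall C : R, 0 < C -> (C%:E < C_infty f T)%E ->
  exists2 M_C : nat, (0 < M_C)%N & forall M, (M_C <= M)%N ->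
    err f (x M) (p M) g <=
      s * (err f (x M) (q M) r + 2 / Num.sqrt C * verr f (x M) (q M) T).
Proof.
move=> b s r p h_bounded C C0 Cinf.
pose h y := g y - b y.
have [M0 _ pos_part_moment] :=
  near_pos_part_moment_ge f_density T_cont T_bounded q_distr Q_cvg Cinf.
exists (maxn 1 M0); first by rewrite leq_max.
move=> M; rewrite geq_max => /andP[M_gt0 M0M].
have qM := q_distr M M_gt0.
have [lmax _] := lambda_max M M_gt0.
have hs y : `|h y| <= s by exact: sup_norm_ge.
have ch : continuous h.
  apply: continuous_sub => //; apply: continuous_lincomb => l.
  exact: continuous_coord.
have s_ge0 : 0 <= s by exact: le_trans (hs 0).
(* true also for s = 0: then h vanishes identically *)
have hE : h = (fun y => s * r y).
  apply/funext => y; rewrite /r mulrC.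
  have [s0|s0] := eqVneq s 0; last by rewrite divfK.
  by rewrite s0 mulr0; apply/normr0_eq0/le_anti; rewrite normr_ge0 andbT -s0 hs.
have cr : continuous r by apply: continuous_mul => //; exact: continuous_const.
have r1 y : `|r y| <= 1.
  have [s0|s0] := eqVneq s 0; first by rewrite /r s0 invr0 mulr0 normr0.
  rewrite normrM normfV (ger0_norm s_ge0) ler_pdivrMr ?mul1r ?hs//.
  by rewrite lt_neqAle eq_sym s0.
have errh : err f (x M) (q M) h = s * err f (x M) (q M) r.
  rewrite /err hE (@expectZ _ _ _ f_density _ _ 1 cr) => [|y _]; last exact: r1.
  rewrite -[X in _ = X * _](ger0_norm s_ge0) -normrM mulrBr; congr `|_ - _|.
  by rewrite /dexpect big_distrr/=; apply: eq_bigr => i _; rewrite mulrCA.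
rewrite (err_residual f_density T_cont T_bounded g_cont hs (tilt_moment qM lmax)).
apply: (le_trans (err_le_reweighted _ _ _ (q M) hs)).
rewrite errh mulrDr lerD2l ler_wpM2l//.
exact: (tilt_dist_le_verr qM lmax C0 (pos_part_moment M M0M)).
Qed.
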